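(* Let $H$ be a pointed Hopf algebra over a field $\mathbb{K}$, let $G$ be the group of grouplike elements of $H$, and assume that $G$ is finite and that the antipode of $H$ is invertible. Then any symmetric partial left $H$-module algebra $A$ decomposes, as an algebra, into a direct sum $$A=\bigoplus_{X\in\mathcal{P}_1(G)}A\,P^A_X$$ of unital ideals, where $\mathcal{P}_1(G)=\{X\subseteq G\mid 1_H\in X\}$ and $$P^A_X=\prod_{x\in X}(x\cdot 1_A)\prod_{y\in G\setminus X}(1_A-(y\cdot 1_A))$$ are central idempotents of $A$, for all $X\in\mathcal{P}_1(G)$.
   Context: Sweedler notation $\Delta(h)=h_{1}\otimes h_{2}$ is used. A Hopf algebra is pointed if all its simple subcoalgebras are one-dimensional. A symmetric partial left $H$-module algebra is a unital algebra $A$ with a linear map $H\otimes A\to A$, $h\otimes a\mapsto h\cdot a$, such that for all $h,k\in H$, $a,b\in A$: $1_H\cdot a=a$; $h\cdot(ab)=(h_1\cdot a)(h_2\cdot b)$; $h\cdot(k\cdot a)=(h_1\cdot 1_A)(h_2k\cdot a)$; and $h\cdot(k\cdot a)=(h_1k\cdot a)(h_2\cdot 1_A)$. Some of the elements $P^A_X$ may be zero; an ideal $AP^A_X$ is unital with unit $P^A_X$. *)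

(* Defs.v *)
From HB Require Import structures.
From mathcomp Require Import all_boot all_order all_algebra finmap.
From mathcomp Require Import boolp classical_sets cardinality.

Set Implicit Arguments.
Unset Strict Implicit.
Unset Printing Implicit Defensive.

Import GRing.Theory.

Local Open Scope quotient_scope.
Local Open Scope classical_set_scope.
Local Open Scope ring_scope.

(* Tensor products of vector spaces of arbitrary dimension. Finite formal sums
   of pairs are sequences of pairs (scalars are absorbed in the left factor);
   two of them are identified when every bilinear map takes the same value on
   both. [tlift_pure], [tlift_linear] and [tlift_unique] below are the
   universal property. *)
Section Tensor.
Variables (K : fieldType) (U V : lmodType K).
Implicit Types s t : seq (U * V).

Definition formal_eval (W : lmodType K) (f : U -> V -> W) s : W :=
  \sum_(p <- s) f p.1 p.2.

Definition tensor_equiv s t : bool :=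
  `[< forall (W : lmodType K) (f : {bilinear U -> V -> W}),
        formal_eval f s = formal_eval f t >].

Lemma tensor_equivP s t :
  reflect (forall (W : lmodType K) (f : {bilinear U -> V -> W}),
             formal_eval f s = formal_eval f t) (tensor_equiv s t).
Proof. exact: asboolP. Qed.

Lemma tensor_equiv_is_equiv : equiv_class_of tensor_equiv.
Proof.
split=> [s | s t | t s u].
- exact/tensor_equivP.
- by apply/tensor_equivP/tensor_equivP => E W f; rewrite E.
- move=> /tensor_equivP E1 /tensor_equivP E2.
  by apply/tensor_equivP => W f; rewrite E1 E2.
Qed.

Canonical tensor_equivRel := EquivRelPack tensor_equiv_is_equiv.
Canonical tensor_encModRel := defaultEncModRel tensor_equiv.

Definition tensor := {eq_quot tensor_equiv}.
HB.instance Definition _ : EqQuotient _ tensor_equiv tensor :=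
  EqQuotient.on tensor.
HB.instance Definition _ := Choice.on tensor.

Definition tclass s : tensor := \pi_tensor s.

Lemma tclassP s t :
  (forall (W : lmodType K) (f : {bilinear U -> V -> W}),
     formal_eval f s = formal_eval f t) <-> tclass s = tclass t.
Proof.
split=> [E | /eqmodP /tensor_equivP //].
by apply/eqmodP/tensor_equivP.
Qed.

Lemma repr_tclass (W : lmodType K) (f : {bilinear U -> V -> W}) s :
  formal_eval f (repr (tclass s)) = formal_eval f s.
Proof. by move: W f; apply/tclassP; rewrite /tclass reprK. Qed.

Lemma tclass_repr (t : tensor) : tclass (repr t) = t.
Proof. exact: reprK. Qed.

Definition formal_scale (a : K) s := [seq (a *: p.1, p.2) | p <- s].

Lemma formal_eval_cat (W : lmodType K) (f : U -> V -> W) s t :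
  formal_eval f (s ++ t) = formal_eval f s + formal_eval f t.
Proof. exact: big_cat. Qed.

Lemma formal_eval_scale (W : lmodType K) (f : {bilinear U -> V -> W}) a s :
  formal_eval f (formal_scale a s) = a *: formal_eval f s.
Proof.
rewrite /formal_eval big_map scaler_sumr; apply: eq_bigr => p _ /=.
by rewrite linearZl_LR.
Qed.

Lemma formal_eval_nil (W : lmodType K) (f : U -> V -> W) :
  formal_eval f [::] = 0.
Proof. exact: big_nil. Qed.

Definition tensor_add (x y : tensor) := tclass (repr x ++ repr y).
Definition tensor_zero := tclass [::].
Definition tensor_scale a (x : tensor) := tclass (formal_scale a (repr x)).
Definition tensor_opp (x : tensor) := tensor_scale (-1) x.

Lemma tensor_ext (x y : tensor) :
  (forall (W : lmodType K) (f : {bilinear U -> V -> W}),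
     formal_eval f (repr x) = formal_eval f (repr y)) -> x = y.
Proof. by move=> E; rewrite -(tclass_repr x) -(tclass_repr y); apply/tclassP. Qed.

Let evalE := (repr_tclass, formal_eval_cat, formal_eval_scale, formal_eval_nil).

Fact tensor_addA : associative tensor_add.
Proof. by move=> x y z; apply: tensor_ext => W f; rewrite !evalE addrA. Qed.
Fact tensor_addC : commutative tensor_add.
Proof. by move=> x y; apply: tensor_ext => W f; rewrite !evalE addrC. Qed.
Fact tensor_add0 : left_id tensor_zero tensor_add.
Proof. by move=> x; apply: tensor_ext => W f; rewrite !evalE add0r. Qed.
Fact tensor_addN : left_inverse tensor_zero tensor_opp tensor_add.
Proof.
by move=> x; apply: tensor_ext => W f; rewrite !evalE scaleN1r addNr.
Qed.

HB.instance Definition _ := GRing.isZmodule.Build tensor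
  tensor_addA tensor_addC tensor_add0 tensor_addN.

Fact tensor_scaleA a b x :
  tensor_scale a (tensor_scale b x) = tensor_scale (a * b) x.
Proof. by apply: tensor_ext => W f; rewrite !evalE scalerA. Qed.
Fact tensor_scale1 : left_id 1 tensor_scale.
Proof. by move=> x; apply: tensor_ext => W f; rewrite !evalE scale1r. Qed.
Fact tensor_scaleDr : right_distributive tensor_scale +%R.
Proof. by move=> a x y; apply: tensor_ext => W f; rewrite !evalE scalerDr. Qed.
Fact tensor_scaleDl x : {morph tensor_scale^~ x : a b / a + b}.
Proof. by move=> a b; apply: tensor_ext => W f; rewrite !evalE scalerDl. Qed.

HB.instance Definition _ := GRing.Zmodule_isLmodule.Build K tensor
  tensor_scaleA tensor_scale1 tensor_scaleDr tensor_scaleDl.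

Definition pure (u : U) (v : V) : tensor := tclass [:: (u, v)].

(* For bilinear [f], the value at [t] of the linear map induced by [f]: if [t]
   is the sum of the [x_i (x) y_i], then [tlift f t] is the sum of the
   [f x_i y_i]. For a function [f] that is not bilinear the result depends on
   the representative chosen by [repr]. *)
Definition tlift (W : lmodType K) (f : U -> V -> W) (t : tensor) : W :=
  formal_eval f (repr t).

Lemma tlift_pure (W : lmodType K) (f : {bilinear U -> V -> W}) u v :
  tlift f (pure u v) = f u v.
Proof. by rewrite /tlift evalE /formal_eval big_seq1. Qed.

Lemma tlift_linear (W : lmodType K) (f : {bilinear U -> V -> W}) :
  linear (tlift f).
Proof. by move=> a x y; rewrite /tlift !evalE. Qed.

Lemma pure_is_bilinear : bilinear_for *:%R *:%R pure.
Proof.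
split=> [v a u u' | u a v v']; apply: tensor_ext => W f.
  by rewrite !evalE /formal_eval !big_seq1 /= linearPl.
by rewrite !evalE /formal_eval !big_seq1 /= linearPr.
Qed.

HB.instance Definition _ :=
  bilinear_isBilinear.Build K U V tensor *:%R *:%R pure pure_is_bilinear.

Lemma tensorE (t : tensor) : t = \sum_(p <- repr t) pure p.1 p.2.
Proof.
have tcons p s : tclass (p :: s) = pure p.1 p.2 + tclass s.
  apply: tensor_ext => W f.
  by rewrite !evalE /formal_eval big_cons big_seq1.
rewrite -{1}(tclass_repr t); elim: (repr t) => [|p s IHs]; first by rewrite big_nil.
by rewrite big_cons tcons IHs.
Qed.

Lemma tlift_unique (W : lmodType K) (f : {bilinear U -> V -> W})
    (g : {linear tensor -> W}) :
  (forall u v, g (pure u v) = f u v) -> g =1 tlift f.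
Proof.
move=> gE t; rewrite {1}(tensorE t) linear_sum.
by apply: eq_bigr => p _; rewrite gE.
Qed.

End Tensor.

Notation "x ⊗ y" := (pure x y) (at level 40, left associativity) : ring_scope.

(* Sweedler sums: [\tsum_(h1 ⊗ h2 <- comul h) F h1 h2]. *)
Notation "\tsum_( x ⊗ y <- t ) F" := (tlift (fun x y => F) t)
  (at level 41, F at level 41, x name, y name, t at level 50,
   format "\tsum_( x  ⊗  y  <-  t )  F") : ring_scope.

HB.mixin Record Lmodule_isCoalgebra (K : fieldType) C of GRing.Lmodule K C := {
  comul : {linear C -> tensor C C};
  counit : {scalar C};
  comulA : forall c : C,
    \tsum_(x ⊗ y <- comul c) (\tsum_(x1 ⊗ x2 <- comul x) (x1 ⊗ (x2 ⊗ y)))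
    = \tsum_(x ⊗ y <- comul c) (x ⊗ comul y);
  counitl : forall c : C, \tsum_(x ⊗ y <- comul c) (counit x *: y) = c;
  counitr : forall c : C, \tsum_(x ⊗ y <- comul c) (counit y *: x) = c
}.

#[short(type="coalgType")]
HB.structure Definition Coalgebra (K : fieldType) :=
  {C of Lmodule_isCoalgebra K C & GRing.Lmodule K C}.

HB.mixin Record Algebra_Coalgebra_isBialgebra (K : fieldType) B
    of GRing.Algebra K B & Coalgebra K B := {
  comul1 : comul (1 : B) = 1 ⊗ 1;
  comulM : forall h k : B,
    comul (h * k)
    = \tsum_(h1 ⊗ h2 <- comul h) \tsum_(k1 ⊗ k2 <- comul k)
        ((h1 * k1) ⊗ (h2 * k2));
  counit1 : counit (1 : B) = 1;
  counitM : forall h k : B, counit (h * k) = counit h * counit k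
}.

#[short(type="bialgType")]
HB.structure Definition Bialgebra (K : fieldType) :=
  {B of GRing.Algebra K B & Coalgebra K B & Algebra_Coalgebra_isBialgebra K B}.

HB.mixin Record Bialgebra_isHopfAlgebra (K : fieldType) H
    of Bialgebra K H := {
  antipode : {linear H -> H};
  antipodel : forall h : H,
    \tsum_(h1 ⊗ h2 <- comul h) (antipode h1 * h2) = counit h *: 1;
  antipoder : forall h : H,
    \tsum_(h1 ⊗ h2 <- comul h) (h1 * antipode h2) = counit h *: 1
}.

#[short(type="hopfAlgType")]
HB.structure Definition HopfAlgebra (K : fieldType) :=
  {H of Bialgebra_isHopfAlgebra K H & Bialgebra K H}.

Section Coalgebras.
Variables (K : fieldType) (C : coalgType K).

Definition grouplike : set C := [set g | comul g = g ⊗ g /\ counit g = 1].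

Definition subcoalgebra (D : set C) : Prop :=
  submod_closed [in D] /\
  forall d, D d -> exists2 s : seq (C * C),
    (forall p, p \in s -> D p.1 /\ D p.2) &
    comul d = \sum_(p <- s) p.1 ⊗ p.2.

Definition simple_subcoalgebra (D : set C) : Prop :=
  [/\ subcoalgebra D, D <> [set 0] &
      forall E, subcoalgebra E -> E `<=` D -> E = [set 0] \/ E = D].

Definition one_dimensional (D : set C) : Prop :=
  exists2 d : C, d != 0 & D = [set a *: d | a in [set: K]].

Definition pointed : Prop :=
  forall D, simple_subcoalgebra D -> one_dimensional D.

End Coalgebras.

Arguments grouplike {K} C.
Arguments pointed {K} C.

(* Associative unital algebras. The type [algType K] only has nonzero algebras;
   here the zero algebra is allowed. *)
Record unitalAlgType (K : fieldType) := UnitalAlg {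
  ualg_ring : pzRingType;
  ualg_scale : K -> ualg_ring -> ualg_ring;
  ualg_scaleA : forall a b x,
    ualg_scale a (ualg_scale b x) = ualg_scale (a * b) x;
  ualg_scale1 : left_id 1 ualg_scale;
  ualg_scaleDr : right_distributive ualg_scale +%R;
  ualg_scaleDl : forall x, {morph ualg_scale^~ x : a b / a + b};
  ualg_scaleAl : forall a x y, ualg_scale a (x * y) = ualg_scale a x * y;
  ualg_scaleAr : forall a x y, ualg_scale a (x * y) = x * ualg_scale a y
}.

Definition ualg_sort (K : fieldType) (A : unitalAlgType K) : Type :=
  ualg_ring A.
Coercion ualg_sort : unitalAlgType >-> Sortclass.

Section UnitalAlgebraInstances.
Variables (K : fieldType) (A : unitalAlgType K).

HB.instance Definition _ := GRing.PzRing.on (ualg_sort A).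
HB.instance Definition _ := GRing.Zmodule_isLmodule.Build K (ualg_sort A)
  (@ualg_scaleA K A) (@ualg_scale1 K A) (@ualg_scaleDr K A) (@ualg_scaleDl K A).

End UnitalAlgebraInstances.

Definition unitalAlg_of_algType (K : fieldType) (A : algType K) :
    unitalAlgType K :=
  @UnitalAlg K A (fun a x => a *: x)
    (@scalerA K A) (@scale1r K A) (@scalerDr K A)
    (fun x a b => scalerDl x a b) (@scalerAl K A) (@scalerAr K A).

Section PartialActions.
Variables (K : fieldType) (H : hopfAlgType K) (A : unitalAlgType K).
Variable act : {linear tensor H A -> A}.

Local Notation "h · a" := (act (h ⊗ a)) (at level 39, left associativity).
Local Notation "1_A" := (1 : A).

Record symmetric_partial_action : Prop := SymmetricPartialAction {
  pact1 : forall a : A, 1 · a = a;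
  pactM : forall (h : H) (a b : A),
    h · (a * b) = \tsum_(h1 ⊗ h2 <- comul h) ((h1 · a) * (h2 · b));
  pact_comp : forall (h k : H) (a : A),
    h · (k · a) = \tsum_(h1 ⊗ h2 <- comul h) ((h1 · 1_A) * ((h2 * k) · a));
  pact_comp_sym : forall (h k : H) (a : A),
    h · (k · a) = \tsum_(h1 ⊗ h2 <- comul h) (((h1 * k) · a) * (h2 · 1_A))
}.

(* The products run over the enumerations of the finite sets; their factors
   commute whenever [act] is a symmetric partial action and [G] consists of
   grouplike elements. *)
Definition partial_idem (G X : {fset H}) : A :=
  (\prod_(x <- X) (x · 1_A)) * (\prod_(y <- (G `\` X)%fset) (1 - y · 1_A)).

End PartialActions.

Definition subsets1 (K : fieldType) (H : hopfAlgType K) (G : {fset H}) :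
    {fset {fset H}} :=
  [fset X in fpowerset G | 1 \in X]%fset.

Section Ideals.
Variables (K : fieldType) (A : unitalAlgType K).

Definition central_idempotent (e : A) : Prop :=
  e * e = e /\ forall a, a * e = e * a.

Definition two_sided_ideal (I : set A) : Prop :=
  submod_closed [in I] /\ forall a x, I x -> I (a * x) /\ I (x * a).

Definition ideal_unit (I : set A) (e : A) : Prop :=
  I e /\ forall x, I x -> e * x = x /\ x * e = x.

Definition left_multiples (e : A) : set A := [set a * e | a in [set: A]].

(* [A] is the internal direct sum, as an algebra, of the [I i] for [i] in [J]:
   every element is uniquely a sum of components in the [I i], and products are
   computed componentwise. *)
Definition algebra_direct_sum (T : choiceType) (J : {fset T})
    (I : T -> set A) : Prop :=
  [/\ forall i, i \in J -> two_sided_ideal (I i),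
      forall a, exists2 f : T -> A,
        (forall i, i \in J -> I i (f i)) & a = \sum_(i <- J) f i,
      forall f g : T -> A,
        (forall i, i \in J -> I i (f i)) -> (forall i, i \in J -> I i (g i)) ->
        \sum_(i <- J) f i = \sum_(i <- J) g i ->
        forall i, i \in J -> f i = g i
    & forall i j x y, i \in J -> j \in J -> i != j -> I i x -> I j y ->
        x * y = 0].

End Ideals.

(* Main.v *)
Require Import Defs.
From HB Require Import structures.
From mathcomp Require Import all_boot all_order all_algebra finmap.
From mathcomp Require Import boolp classical_sets cardinality.

(** The elements [x · 1], for [x] grouplike, are central idempotents of [A], and
the [P X] are the atoms of the Boolean algebra which they generate.

Idempotence is the multiplicativity of the action on [1 * 1]. For centrality,
the composition axiom and its symmetric version evaluate
[x · (S x · a)] as [(x · 1) * (x (S x) · a)] and as [(x (S x) · a) * (x · 1)];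
since [x (S x) = 1], these are [(x · 1) * a] and [a * (x · 1)]
([grouplike_act1_central]).

The rest is about a finite family [e] of central idempotents in a ring. Each
atom is cut out by the sign conditions [e g * x = x] for [g] in [X] and
[e g * x = 0] for [g] in [G] outside [X]: it acts as [1] on the solutions for
[X] ([atom_mul_id]) and as [0] on the solutions for the other subsets
([atom_mul0]). As it solves its own conditions ([atom_pattern]), the atoms are
orthogonal idempotents. Splitting [1 = e g + (1 - e g)] for one [g] after
another shows that only [0] kills every solution of every sign pattern
([pattern_separation]); applied to [1] minus the sum of the atoms, this gives
[1] as the sum of the atoms ([sum_atoms]). The subsets without the unit of [H]
contribute nothing, since [1 · 1 = 1] leaves no nonzero solution of
[e 1 * x = 0]. Finally, a complete orthogonal family of central idempotents
decomposes the algebra ([direct_sum_idempotents]). *)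

Import GRing.Theory.

Local Open Scope classical_set_scope.
Local Open Scope ring_scope.

(** * Atoms of a finite family of central idempotents *)

Section CentralIdempotents.
Variables (R : pzRingType) (T : choiceType) (e : T -> R) (G : {fset T}).

Definition central (c : R) : Prop := forall a, a * c = c * a.

Lemma central_prod (s : seq T) (F : T -> R) :
  (forall x, x \in s -> central (F x)) -> central (\prod_(x <- s) F x).
Proof.
elim: s => [|x s IHs] Fc a; first by rewrite big_nil mulr1 mul1r.
rewrite big_cons mulrA (Fc x) ?mem_head // -!mulrA IHs // => y ys.
by apply: Fc; rewrite inE ys orbT.
Qed.

Lemma central_onem {c : R} : central c -> central (1 - c).
Proof. by move=> cc a; rewrite mulrBr mulrBl mulr1 mul1r cc. Qed.

Lemma prod_mul_id (s : seq T) (F : T -> R) (x : R) :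
  (forall g, g \in s -> F g * x = x) -> (\prod_(g <- s) F g) * x = x.
Proof.
elim: s => [|g s IHs] Fx; first by rewrite big_nil mul1r.
rewrite big_cons -mulrA IHs ?Fx ?mem_head // => h hs.
by apply: Fx; rewrite inE hs orbT.
Qed.

(** Centrality of [c] lets it travel to the factor [F g]. *)
Lemma central_mul_prod (c d : R) (s : seq T) (F : T -> R) (g : T) :
  central c -> central d -> g \in s -> c * F g = d * F g ->
  c * \prod_(x <- s) F x = d * \prod_(x <- s) F x.
Proof.
move=> cc dc + cd; elim: s => // h s IHs; rewrite inE big_cons.
case/predU1P => [<-|/IHs E]; first by rewrite !mulrA cd.
by rewrite !mulrA -cc -dc -!mulrA E.
Qed.

Definition atom (X : {fset T}) : R :=
  (\prod_(x <- X) e x) * \prod_(y <- (G `\` X)%fset) (1 - e y).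

Definition has_pattern (X : {fset T}) (x : R) : Prop :=
  forall g, g \in G -> e g * x = if g \in X then x else 0.

Hypothesis e_central : forall g, g \in G -> central (e g).
Hypothesis e_idem : forall g, g \in G -> e g * e g = e g.

Lemma atom_central {X : {fset T}} : (X `<=` G)%fset -> central (atom X).
Proof.
move=> /fsubsetP XG a.
have c1 : central (\prod_(x <- X) e x).
  by apply: central_prod => x /XG; apply: e_central.
have c2 : central (\prod_(y <- (G `\` X)%fset) (1 - e y)).
  apply: central_prod => y; rewrite inE => /andP[_ yG].
  exact/central_onem/e_central.
by rewrite /atom mulrA c1 -!mulrA c2.
Qed.

Lemma atom_pattern {X : {fset T}} : has_pattern X (atom X).
Proof.
have c1 : central 1 by move=> a; rewrite mulr1 mul1r.
have c0 : central 0 by move=> a; rewrite mulr0 mul0r.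
move=> g gG; have cg := e_central g gG; rewrite /atom.
case: ifPn => gX.
  rewrite mulrA (central_mul_prod (e g) 1 X e g) ?mul1r //.
  exact: e_idem.
rewrite mulrA -cg -mulrA (central_mul_prod (e g) 0 _ _ g) ?mul0r ?mulr0 //.
  by rewrite inE gX gG.
by rewrite mulrBr mulr1 e_idem // subrr.
Qed.

Lemma atom_mul_id {X : {fset T}} {x : R} :
  (X `<=` G)%fset -> has_pattern X x -> atom X * x = x.
Proof.
move=> /fsubsetP XG xX; rewrite /atom -mulrA [Y in _ * Y]prod_mul_id.
  by apply: prod_mul_id => g gX; rewrite xX ?XG // gX.
move=> g; rewrite inE => /andP[gX gG].
by rewrite mulrBl mul1r xX // (negPf gX) subr0.
Qed.

(** At an index [g] where the two subsets differ, [e g] acts as [1] on one of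
the factors and as [0] on the other. *)
Lemma atom_mul0 {X Y : {fset T}} {x : R} :
  (X `<=` G)%fset -> (Y `<=` G)%fset -> X != Y ->
  has_pattern X x -> atom Y * x = 0.
Proof.
move=> XG YG XY xX.
have [g gG gXY] : exists2 g, g \in G & (g \in X) != (g \in Y).
  apply: contrapT => no; case/eqP: XY; apply/fsetP => g.
  have [gG|gG] := boolP (g \in G).
    by apply/eqP; apply: contrapT => /negP gXY; apply: no; exists g.
  by rewrite (contraNF (fsubsetP XG g)) ?(contraNF (fsubsetP YG g)).
have := xX g gG; have := atom_pattern (X := Y) g gG.
rewrite -e_central //; case: (g \in X) (g \in Y) gXY => [] [] //= _ E F.
  by rewrite -F mulrA E mul0r.
by rewrite -E -mulrA F mulr0.
Qed.

(** By [x = x * e g + x * (1 - e g)], an element is a sum of two elements on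
which the sign of [e g] is decided, while the other signs are kept. From [1],
this produces sums of solutions of sign patterns. *)
Lemma pattern_separation (r : R) :
  (forall (X : {fset T}) x, (X `<=` G)%fset -> has_pattern X x -> r * x = 0) ->
  r = 0.
Proof.
move=> rP.
(* Only the sign conditions indexed by [s] are imposed, so that the indices can
   be removed one at a time. *)
suff main (s : seq T) : {subset s <= G} ->
    (forall x, (forall g, g \in s -> e g * x = x \/ e g * x = 0) -> r * x = 0) ->
    r = 0.
  apply: (main G) => // x xG.
  apply: (rP [fset g in G | e g * x == x]%fset).
    by apply/fsubsetP => g; rewrite !inE => /andP[].
  move=> g gG; rewrite !inE gG /=; case: eqP => //.
  by case: (xG g gG).
elim: s => [_ r0|g s IHs sG r0]; first by rewrite -[r]mulr1 r0.
have gG : g \in G by rewrite sG ?mem_head.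
apply: IHs => [h hs|x xs]; first by rewrite sG // inE hs orbT.
have split_r y : (y = x * e g \/ y = x * (1 - e g)) -> r * y = 0.
  move=> yE; apply: r0 => h; rewrite inE => /predU1P[->|hs].
    case: yE => ->; rewrite -e_central // -mulrA; [left | right].
      by rewrite e_idem.
    by rewrite mulrBl mul1r e_idem // subrr mulr0.
  by case: (xs h hs) => E; [left | right];
    case: yE => ->; rewrite mulrA E ?mul0r.
rewrite -[x]mulr1 -(subrK (e g) 1) mulrDr mulrDr.
by rewrite !split_r ?addr0; [|left|right].
Qed.

(** On a solution of the pattern [X], only the atom of [X] acts as [1] and the
others vanish; so [1] and the sum agree on it. If [X] is not in [J], the second
hypothesis leaves only the solution [0]. *)
Lemma sum_atoms (J : {fset {fset T}}) :
  (forall X, X \in J -> (X `<=` G)%fset) ->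
  (forall X x, (X `<=` G)%fset -> X \notin J -> has_pattern X x -> x = 0) ->
  \sum_(X <- J) atom X = 1.
Proof.
move=> JG J0; apply/esym/eqP; rewrite -subr_eq0; apply/eqP.
apply: pattern_separation => X x XG xX.
rewrite mulrBl mul1r mulr_suml.
have [XJ|XJ] := boolP (X \in J); last first.
  by rewrite (J0 X x) // big1 ?subr0 // => Y _; rewrite mulr0.
rewrite (bigD1_seq X) ?fset_uniq //= (atom_mul_id XG xX).
rewrite big_seq_cond big1 ?addr0 ?subrr // => Y /andP[YJ YX].
by apply: (atom_mul0 XG _ _ xX); [apply: JG | rewrite eq_sym].
Qed.

End CentralIdempotents.

(** * The ideals generated by central idempotents *)

Section IdempotentIdeals.
Variables (K : fieldType) (A : unitalAlgType K).

Lemma left_multiples_ideal {e : A} :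
  central_idempotent e -> two_sided_ideal (left_multiples e).
Proof.
move=> [_ ec]; split.
  split=> [|a x y]; rewrite !inE; first by exists 0 => //; rewrite mul0r.
  move=> [b _ <-] [c _ <-].
  exists (a *: b + c) => //.
  by rewrite mulrDl; congr (_ + _); rewrite -[LHS]ualg_scaleAl.
move=> a _ [b _ <-]; split; first by exists (a * b) => //; rewrite mulrA.
by exists (b * a) => //; rewrite -!mulrA ec.
Qed.

Lemma left_multiples_unit {e : A} :
  central_idempotent e -> ideal_unit (left_multiples e) e.
Proof.
move=> [ee ec]; split; first by exists 1 => //; rewrite mul1r.
move=> _ [b _ <-]; split; last by rewrite -mulrA ee.
by rewrite -ec -mulrA ee.
Qed.

Lemma direct_sum_idempotents (T : choiceType) (J : {fset T}) (e : T -> A) :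
  (forall i, i \in J -> central_idempotent (e i)) ->
  (forall i j, i \in J -> j \in J -> i != j -> e i * e j = 0) ->
  \sum_(i <- J) e i = 1 ->
  algebra_direct_sum J (fun i => left_multiples (e i)).
Proof.
move=> eI e0 e1.
have orth i j x y : i \in J -> j \in J -> i != j ->
    left_multiples (e i) x -> left_multiples (e j) y -> x * y = 0.
  move=> iJ jJ ij [a _ <-] [b _ <-].
  by rewrite mulrA -(mulrA a) -(eI i iJ).2 mulrA -mulrA e0 // mulr0.
(* Multiplication by [e i] extracts the component in [left_multiples (e i)]. *)
have proj (f : T -> A) i : (forall j, j \in J -> left_multiples (e j) (f j)) ->
    i \in J -> e i * \sum_(j <- J) f j = f i.
  move=> fI iJ; have [ei eU] := left_multiples_unit (eI i iJ).
  rewrite mulr_sumr (bigD1_seq i) ?fset_uniq //= (eU _ (fI i iJ)).1.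
  rewrite big_seq_cond big1 ?addr0 // => j /andP[jJ ji].
  by apply: (orth i j _ _ iJ jJ _ ei (fI j jJ)); rewrite eq_sym.
split=> // [i iJ|a|f g fI gI fg i iJ].
- exact/left_multiples_ideal/eI.
- exists (fun i => a * e i); first by move=> i _; exists a.
  by rewrite -mulr_sumr e1 mulr1.
- by rewrite -(proj f) // fg proj.
Qed.

End IdempotentIdeals.

(** * Grouplike elements acting on the unit *)

(** The bilinearity of [f] as a side condition, for maps [f] which carry no
bilinear structure. *)
Lemma tlift_pure_bilinear (K : fieldType) (U V W : lmodType K)
    (f : U -> V -> W) (u : U) (v : V) :
  (forall y, linear (f^~ y)) -> (forall x, linear (f x)) ->
  tlift f (u ⊗ v) = f u v.
Proof.
move=> fl fr.
have fB : bilinear_for *:%R *:%R f by split.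
pose F := bilinear_isBilinear.Build K U V W *:%R *:%R f fB.
pose g : {bilinear U -> V -> W} := HB.pack f F.
exact: (tlift_pure g).
Qed.

Section GrouplikeAction.
Variables (K : fieldType) (H : hopfAlgType K) (A : unitalAlgType K).
Variable act : {linear tensor H A -> A}.
Hypothesis act_sym : symmetric_partial_action act.

Local Notation "h · a" := (act (h ⊗ a)) (at level 39, left associativity).
Local Notation "1_A" := (1 : A).

Lemma grouplike1 : grouplike H 1.
Proof. by split; [apply: comul1 | apply: counit1]. Qed.

Lemma act_pure_linear (a : A) : linear (fun h : H => h · a).
Proof. by move=> c h k; rewrite linearPl linearP. Qed.

Lemma act_pure_mulr_linear (k : H) (a : A) : linear (fun h : H => (h * k) · a).
Proof. by move=> c h h'; rewrite mulrDl -scalerAl act_pure_linear. Qed.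

(** A product of two linear maps with values in [A] is bilinear, so the Sweedler
sum over [x ⊗ x] is a single product. *)
Lemma grouplike_tsum_mul (u v : H -> A) (x : H) :
  grouplike H x -> linear u -> linear v ->
  \tsum_(x1 ⊗ x2 <- comul x) (u x1 * v x2) = u x * v x.
Proof.
move=> [-> _] ul vl; apply: (tlift_pure_bilinear _ _ _ _ (fun y z => u y * v z)).
  by move=> y c h k; rewrite ul mulrDl; congr (_ + _); rewrite -[LHS]ualg_scaleAl.
by move=> y c h k; rewrite vl mulrDr; congr (_ + _); rewrite -[LHS]ualg_scaleAr.
Qed.

Lemma grouplike_mul_antipode (x : H) : grouplike H x -> x * antipode x = 1.
Proof.
move=> [xx x1]; have := antipoder x.
rewrite xx x1 scale1r tlift_pure_bilinear // => y c h k.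
  by rewrite mulrDl scalerAl.
by rewrite linearP mulrDr scalerAr.
Qed.

Lemma grouplike_act1_idem (x : H) : grouplike H x -> (x · 1_A) * (x · 1_A) = x · 1_A.
Proof.
move=> xG; rewrite -[in RHS](mulr1 1_A) (pactM act_sym).
by rewrite (grouplike_tsum_mul _ _ _ xG (act_pure_linear 1_A) (act_pure_linear 1_A)).
Qed.

(** The two composition axioms for [x · (S x · a)] put the factor [x · 1] on
opposite sides of [a]. *)
Lemma grouplike_act1_central (x : H) :
  grouplike H x -> central A (x · 1_A).
Proof.
move=> xG a; have xS := grouplike_mul_antipode x xG.
have := pact_comp act_sym x (antipode x) a.
rewrite (pact_comp_sym act_sym x (antipode x) a).
have L1 := act_pure_linear 1_A; have L2 := act_pure_mulr_linear (antipode x) a.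
rewrite (grouplike_tsum_mul _ _ _ xG L1 L2) (grouplike_tsum_mul _ _ _ xG L2 L1).
by rewrite xS (pact1 act_sym).
Qed.

End GrouplikeAction.

Theorem proposition2p5 (K : fieldType) (H : hopfAlgType K)
    (H_pointed : pointed H)
    (G_finite : finite_set (grouplike H))
    (S_invertible : bijective (antipode : H -> H))
    (A : unitalAlgType K) (act : {linear tensor H A -> A})
    (act_sym : symmetric_partial_action act) :
  let G : {fset H} := fset_set (grouplike H) in
  let P := partial_idem act G in
  [/\ forall X, X \in subsets1 G -> central_idempotent (P X),
      forall X, X \in subsets1 G ->
        two_sided_ideal (left_multiples (P X)) /\
        ideal_unit (left_multiples (P X)) (P X)
    & algebra_direct_sum (subsets1 G) (fun X => left_multiples (P X))].
Proof.
move=> G P.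
have mem_G x : x \in G -> grouplike H x by rewrite in_fset_set // inE.
have G1 : 1 \in G by rewrite in_fset_set // inE; apply: grouplike1.
pose e (x : H) : A := act (x ⊗ (1 : A)).
have ec g : g \in G -> central A (e g).
  by move=> /mem_G; apply: grouplike_act1_central.
have ei g : g \in G -> e g * e g = e g.
  by move=> /mem_G; apply: grouplike_act1_idem.
have PE X : P X = atom A H e G X by [].
have subG X : X \in subsets1 G -> (X `<=` G)%fset.
  by rewrite !inE fpowersetE => /andP[].
have PI X : X \in subsets1 G -> central_idempotent (P X).
  move=> /subG XG; split; last exact: atom_central.
  exact/atom_mul_id/atom_pattern.
split=> // [X /PI PX|].
  by split; [apply: left_multiples_ideal | apply: left_multiples_unit].
apply: direct_sum_idempotents => // [X Y /subG XG /subG YG XY|].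
  apply: (atom_mul0 A H e G ec ei YG XG); first by rewrite eq_sym.
  exact: atom_pattern.
apply: (sum_atoms A H e G ec ei) => // X x XG XJ xX.
have := xX 1 G1; rewrite /e (pact1 act_sym) mul1r ifN //.
by apply: contraNN XJ => X1; rewrite !inE fpowersetE XG.
Qed.
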